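(* Consider a family of mesh partitions $\Omega=\bigcup_e\Omega_e$ indexed by the mesh size $h\in(0,1]$ (every element has diameter at most $h$), an exact solution $\mathsf U$ that is smooth on $\Omega$, and DG solutions $U$ (one for each $h$) satisfying $$\|U-\mathsf U\|_\Omega\le C_1h^{p+1}$$ with $C_1$ independent of $h$. On each element let ${}^{\mathcal L}U_e=U_e+\varepsilon_e(\overline U_e-U_e)$ with $\varepsilon_e\in[0,1]$ and $\varepsilon_e=\mathcal O(h^p)$, i.e. $\varepsilon_e\le Ch^p$ with $C$ independent of $h$ and $e$. Then there is a constant $C_2$ independent of $h$ such that $$\|{}^{\mathcal L}U-\mathsf U\|_\Omega^2\le C_2h^{2p+2}.$$
   Context: $\|\cdot\|_\Omega$ is the $L_2(\Omega)$ norm on a bounded domain $\Omega\subset\mathbb{R}^{N_d}$; $p\ge1$ is the polynomial order; $U_e$ is the restriction of $U$ to the element $\Omega_e$ (a vector-valued polynomial) and $\overline U_e=\frac{1}{|\Omega_e|}\int_{\Omega_e}U_e\,dx$ its element average; ${}^{\mathcal L}U$ is the function on $\Omega$ with restrictions ${}^{\mathcal L}U_e$. ''Smooth'' means infinitely differentiable with bounded derivatives and Lipschitz continuous on $\Omega$. *)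

(* Defs.v *)
From HB Require Import structures.
From mathcomp Require Import all_boot all_order all_algebra.
From mathcomp Require Import all_classical all_reals all_analysis.
Set Implicit Arguments.
Unset Strict Implicit.
Unset Printing Implicit Defensive.
Import Order.TTheory GRing.Theory Num.Theory.
Import numFieldNormedType.Exports.
Local Open Scope classical_set_scope.
Local Open Scope ring_scope.

(* The product sigma-algebra on row vectors (as for tuples in the library);
   over R it is the Borel sigma-algebra of R^n. *)
Definition measure_rV_display : measure_display -> measure_display.
Proof. exact. Qed.

Section measurable_rV.
Context {d} {T : measurableType d}.
Variable n : nat.

Let coors : 'I_n -> 'rV[T]_n -> T := fun i v => v ord0 i.

Let rV_set0 : g_sigma_preimage coors set0.
Proof. exact: sigma_algebra0. Qed.

Let rV_setC A : g_sigma_preimage coors A -> g_sigma_preimage coors (~` A).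
Proof. exact: sigma_algebraC. Qed.

Let rV_bigcup (F : _^nat) : (forall i, g_sigma_preimage coors (F i)) ->
  g_sigma_preimage coors (\bigcup_i (F i)).
Proof. exact: sigma_algebra_bigcup. Qed.

HB.instance Definition _ := @isMeasurable.Build (measure_rV_display d)
  'rV[T]_n (g_sigma_preimage coors) rV_set0 rV_setC rV_bigcup.

End measurable_rV.

Lemma measurable_coord d (T : measurableType d) n (i : 'I_n) :
  measurable_fun [set: 'rV[T]_n] (fun v => v ord0 i).
Proof.
move=> _ Y mY; rewrite setTI; apply: sub_sigma_algebra => /=.
rewrite -bigcup_seq/=; exists i => /=; first by rewrite mem_index_enum.
by exists Y => //; rewrite setTI.
Qed.

Lemma measurable_fun_rVP d1 d2 (T1 : measurableType d1)
    (T2 : measurableType d2) n (f : T1 -> 'rV[T2]_n) :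
  measurable_fun [set: T1] f <->
  forall i, measurable_fun [set: T1] (fun x => f x ord0 i).
Proof.
split=> [mf i|mf].
  by apply: (measurableT_comp (measurable_coord i) mf).
move=> _ A mA; rewrite setTI.
suff : measurable `<=` [set B : set 'rV[T2]_n | measurable (f @^-1` B)].
  by move/(_ _ mA).
apply: smallest_sub.
  split=> /=.
  - by rewrite preimage_set0.
  - by move=> B mB; rewrite setTD preimage_setC; exact: measurableC.
  - by move=> F mF; rewrite preimage_bigcup; exact: bigcupT_measurable.
rewrite -bigcup_seq => B [i _ [C mC <-]] /=.
by rewrite setTI -[X in measurable X]setTI; exact: mf.
Qed.

Section lebesgue_rV.
Variable R : realType.

Definition consv n (z : R * 'rV[R]_n) : 'rV[R]_n.+1 :=
  \row_i if unlift ord0 i is Some j then z.2 ord0 j else z.1.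

Definition unconsv n (v : 'rV[R]_n.+1) : R * 'rV[R]_n :=
  (v ord0 ord0, \row_j v ord0 (lift ord0 j)).

Lemma consv0 n (z : R * 'rV[R]_n) : consv z ord0 ord0 = z.1.
Proof. by rewrite mxE unlift_none. Qed.

Lemma consv_lift n (z : R * 'rV[R]_n) j :
  consv z ord0 (lift ord0 j) = z.2 ord0 j.
Proof. by rewrite mxE liftK. Qed.

Lemma consvK n : cancel (@consv n) (@unconsv n).
Proof.
move=> z; rewrite /unconsv consv0 [RHS]surjective_pairing; congr pair.
by apply/rowP => j; rewrite mxE consv_lift.
Qed.

Lemma unconsvK n : cancel (@unconsv n) (@consv n).
Proof.
move=> v; apply/rowP => i; case: (unliftP ord0 i) => [j|] ->.
  by rewrite consv_lift mxE.
by rewrite consv0.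
Qed.

Lemma measurable_consv n :
  measurable_fun [set: R * 'rV[R]_n] (@consv n : _ -> 'rV[R]_n.+1).
Proof.
apply/measurable_fun_rVP => i; case: (unliftP ord0 i) => [j|] ->.
  under eq_fun do rewrite consv_lift.
  exact: (measurableT_comp (measurable_coord j) measurable_snd).
under eq_fun do rewrite consv0.
exact: measurable_fst.
Qed.

Lemma measurable_unconsv n :
  measurable_fun [set: 'rV[R]_n.+1] (@unconsv n : _ -> R * 'rV[R]_n).
Proof.
apply/measurable_fun_pairP; split; first exact: measurable_coord.
apply/measurable_fun_rVP => i.
under eq_fun do rewrite /= mxE.
exact: measurable_coord.
Qed.

Section lebesgue_rV_succ.
Variables (n : nat) (m : {sigma_finite_measure set 'rV[R]_n -> \bar R}).
Local Open Scope ereal_scope.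

Definition lebesgue_rV_succ : set 'rV[R]_n.+1 -> \bar R :=
  pushforward (@lebesgue_measure R \x m) (@consv n).

Let mu0 : lebesgue_rV_succ set0 = 0.
Proof. by rewrite /lebesgue_rV_succ /pushforward preimage_set0 measure0. Qed.

Let mu_ge0 A : 0 <= lebesgue_rV_succ A.
Proof. by rewrite /lebesgue_rV_succ /pushforward measure_ge0. Qed.

Let mu_sigma_additive : semi_sigma_additive lebesgue_rV_succ.
Proof.
move=> F mF tF mUF; rewrite /lebesgue_rV_succ /pushforward preimage_bigcup.
apply: measure_semi_sigma_additive.
- by move=> k; rewrite -[X in measurable X]setTI; exact: measurable_consv.
- apply/trivIsetP => /= i j _ _ ij; rewrite -preimage_setI.
  by move/trivIsetP : tF => /(_ _ _ _ _ ij) ->//; rewrite preimage_set0.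
- by rewrite -preimage_bigcup -[X in measurable X]setTI; exact: measurable_consv.
Qed.

HB.instance Definition _ := isMeasure.Build _ _ _ lebesgue_rV_succ
  mu0 mu_ge0 mu_sigma_additive.

Let mu_sigma_finite : sigma_finite setT lebesgue_rV_succ.
Proof.
have /sigma_finiteP[F [TF ndF Foo]] := sigma_finiteT (@lebesgue_measure R).
have /sigma_finiteP[G [TG ndG Goo]] := sigma_finiteT m.
exists (fun k => @unconsv n @^-1` (F k `*` G k)).
  rewrite -preimage_bigcup [X in _ @^-1` X](_ : _ = setT) ?preimage_setT//.
  apply/seteqP; split=> // -[x y] _.
  have [i _ Fix] : (\bigcup_k F k) x by rewrite -TF.
  have [j _ Gjy] : (\bigcup_k G k) y by rewrite -TG.
  exists (maxn i j) => //; split => /=.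
  - by move: x Fix; exact/subsetPset/ndF/leq_maxl.
  - by move: y Gjy; exact/subsetPset/ndG/leq_maxr.
move=> k; have [mFk Fkoo] := Foo k; have [mGk Gkoo] := Goo k; split.
  rewrite -[X in measurable X]setTI.
  by apply: measurable_unconsv => //; exact: measurableX.
rewrite /lebesgue_rV_succ /pushforward -comp_preimage.
rewrite (_ : _ \o _ = id); last by apply/funext; exact: consvK.
by rewrite preimage_id product_measure1E// lte_mul_pinfty// ge0_fin_numE.
Qed.

HB.instance Definition _ := Measure_isSigmaFinite.Build _ _ _
  lebesgue_rV_succ mu_sigma_finite.

End lebesgue_rV_succ.

Fixpoint lebesgue_rV n : {sigma_finite_measure set 'rV[R]_n -> \bar R} :=
  if n is n'.+1 then lebesgue_rV_succ (lebesgue_rV n') else \d_(0 : 'rV[R]_0).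

Lemma lebesgue_rV_box n (a b : 'rV[R]_n) :
  (forall i, a ord0 i <= b ord0 i) ->
  lebesgue_rV n [set v | forall i, v ord0 i \in `[a ord0 i, b ord0 i]] =
  (\prod_(i < n) (b ord0 i - a ord0 i))%:E.
Proof.
elim: n a b => [|n IHn] a b ab.
  by rewrite big_ord0 /= diracE mem_set// => -[].
pose B := [set v : 'rV[R]_n |
  forall i, v ord0 i \in `[a ord0 (lift ord0 i), b ord0 (lift ord0 i)]].
have mB : measurable B.
  rewrite (_ : B = \bigcap_(i in [set: 'I_n]) ((fun v : 'rV[R]_n => v ord0 i)
      @^-1` `[a ord0 (lift ord0 i), b ord0 (lift ord0 i)])).
    apply: fin_bigcap_measurable => [|i _]; first exact: finite_finset.
    by rewrite -[X in measurable X]setTI; exact: measurable_coord.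
  by apply/seteqP; split=> v /= Bv i; [move=> _; apply: Bv | apply: Bv].
rewrite /= /lebesgue_rV_succ /pushforward.
rewrite (_ : _ @^-1` _ = `[a ord0 ord0, b ord0 ord0]%classic `*` B).
  rewrite product_measure1E//= lebesgue_measure_itv/= lte_fin big_ord_recl.
  pose a' : 'rV[R]_n := \row_i a ord0 (lift ord0 i).
  pose b' : 'rV[R]_n := \row_i b ord0 (lift ord0 i).
  have -> : B = [set v | forall i, v ord0 i \in `[a' ord0 i, b' ord0 i]].
    by apply/seteqP; split=> v /= Bv i; have := Bv i; rewrite !mxE.
  rewrite IHn; last by move=> i; rewrite !mxE; exact: ab.
  under eq_bigr do rewrite !mxE.
  have := ab ord0; rewrite le_eqVlt => /predU1P[->|->].
    by rewrite ltxx subrr mul0r mul0e.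
  by rewrite EFinM.
apply/seteqP; split=> [z zB|[x v] [/= xab Bv] i].
  split=> /=; first by have := zB ord0; rewrite /= consv0.
  by move=> i; have := zB (lift ord0 i); rewrite /= consv_lift.
by case: (unliftP ord0 i) => [j|] ->; rewrite ?consv_lift ?consv0.
Qed.

End lebesgue_rV.

Section dg.
Variable R : realType.

Definition enorm n (v : 'rV[R]_n) : R := Num.sqrt (\sum_i v ord0 i ^+ 2).

Definition diameter n (A : set 'rV[R]_n) : \bar R :=
  ereal_sup [set (enorm (x - y))%:E | x in A & y in A].

Definition L2norm n m (Omega : set 'rV[R]_n) (f : 'rV[R]_n -> 'rV[R]_m) :
    \bar R :=
  sqrte (\int[lebesgue_rV R n]_(x in Omega) (enorm (f x) ^+ 2)%:E).

Definition average n m (A : set 'rV[R]_n) (f : 'rV[R]_n -> 'rV[R]_m) :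
    'rV[R]_m :=
  \row_j ((fine (lebesgue_rV R n A))^-1 *
          \int[lebesgue_rV R n]_(x in A) f x ord0 j).

Definition iter_partial n m (s : seq 'I_n) (f : 'rV[R]_n -> 'rV[R]_m) :
    'rV[R]_n -> 'rV[R]_m :=
  foldr (fun i g x => 'D_(delta_mx ord0 i) g x) f s.

Definition smooth n m (Omega : set 'rV[R]_n) (f : 'rV[R]_n -> 'rV[R]_m) :=
  [/\ forall s x, Omega x -> differentiable (iter_partial s f) x,
      forall s, (0 < size s)%N -> [bounded iter_partial s f x | x in Omega] &
      [lipschitz f x | x in Omega]].

(* Degree at most p in each variable separately; in particular, this allows
   every polynomial of total degree at most p. *)
Definition polynomial_order n m (p : nat) (f : 'rV[R]_n -> 'rV[R]_m) :=
  exists c : {ffun 'I_n -> 'I_p.+1} -> 'rV[R]_m,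
    forall x, f x =
      \sum_(k : {ffun 'I_n -> 'I_p.+1}) (\prod_i x ord0 i ^+ k i) *: c k.

(* Elements may share faces, and need not contain their faces: overlaps and
   the covering of Omega are understood up to Lebesgue-null sets. *)
Definition mesh_partition n (Omega : set 'rV[R]_n) N
    (K : 'I_N -> set 'rV[R]_n) :=
  [/\ forall e, measurable (K e),
      forall e, (0 < lebesgue_rV R n (K e))%E,
      forall e e', e != e' -> (lebesgue_rV R n).-negligible (K e `&` K e') &
      (lebesgue_rV R n).-negligible (Omega `+` \bigcup_e K e)].

(* f has restriction fe e to the element K e, up to a null set, so that the
   values on shared faces are irrelevant. *)
Definition has_restrictions n m N (K : 'I_N -> set 'rV[R]_n)
    (f : 'rV[R]_n -> 'rV[R]_m) (fe : 'I_N -> 'rV[R]_n -> 'rV[R]_m) :=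
  forall e, {ae lebesgue_rV R n, forall x, K e x -> f x = fe e x}.

Definition limited n m (A : set 'rV[R]_n) (eps : R)
    (f : 'rV[R]_n -> 'rV[R]_m) : 'rV[R]_n -> 'rV[R]_m :=
  fun x => f x + eps *: (average A f - f x).

End dg.

(* Main.v *)
(** The limiter perturbs [U_e] by [eps_e (avg U_e - U_e)]. The average is the best
constant approximation in L2, so [avg U_e - U_e] is at most [U_e - c] for
[c := Uex x_e], the value of the exact solution at some point of the element;
and [U_e - c] is the DG error plus [Uex - c = O(h)], by Lipschitz continuity.
Multiplied by [eps_e = O(h^p)] and summed over the elements, the [O(h)] term
contributes [O(h^(p+1))].

[U] and [LU] are pinned down only up to null sets, hence need not be measurable,
and [\int] of a non-measurable nonnegative function is a lower integral, which is
not subadditive. Splitting off a measurable summand, as in [ge0_ae_le_integralD],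
is still allowed; it also dispenses with the measurability of [Uex]. *)

Require Import Defs.
From mathcomp Require Import all_boot all_order all_algebra.
From mathcomp Require Import all_classical all_reals all_analysis.
From mathcomp Require Import measurable_realfun ring.
Set Implicit Arguments.
Unset Strict Implicit.
Import Order.TTheory GRing.Theory Num.Theory.
Import numFieldNormedType.Exports.
Local Open Scope classical_set_scope.
Local Open Scope ring_scope.

(** * Lower integrals, and the mean as the best constant in L2 *)

Section integral.
Context d (T : measurableType d) (R : realType).
Variable mu : {measure set T -> \bar R}.

Import HBNNSimple.

(** The integral of [f] is the supremum of the integrals of the simple functions [s] below [f]. For
    such an [s], the positive part of [(s - g) / k] is measurable and almost everywhere below [f'],
    so additivity is used for measurable functions only. *)
Lemma ge0_ae_le_integralD (f f' g : T -> \bar R) (k : R) : 0 < k ->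
  (forall x, 0 <= f x)%E -> (forall x, 0 <= f' x)%E ->
  measurable_fun [set: T] g -> (forall x, 0 <= g x)%E ->
  {ae mu, forall x, (f x <= k%:E * f' x + g x)%E} ->
  (\int[mu]_x f x <= k%:E * \int[mu]_x f' x + \int[mu]_x g x)%E.
Proof.
move=> k0 f0 f'0 mg g0 [Z [mZ Z0 fZ]].
rewrite [leLHS]ge0_integralTE//; apply: ge_ereal_sup => _ [s sf <-].
have ms : measurable_fun [set: T] (EFin \o s) by exact/measurable_EFinP.
pose phi0 (x : T) : \bar R := maxe (0 : \bar R) (k^-1%:E * ((s x)%:E - g x))%E.
have mphi0 : measurable_fun [set: T] phi0.
  apply: measurable_maxe => //; apply: measurable_funeM.
  exact: emeasurable_funB.
(* Vanishing on the null set [Z] puts [phi] below [f'] everywhere: the suprema defining the two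
   integrals are compared pointwise, not almost everywhere. *)
pose phi := phi0 \_ (~` Z).
have mphi : measurable_fun [set: T] phi.
  apply/(measurable_restrictT _ _).1; first exact: measurableC.
  exact: measurable_funTS.
have phi_ge0 x : (0 <= phi x)%E.
  by rewrite /phi patchE; case: ifP => // _; rewrite /phi0 le_max lexx.
have phif' x : (phi x <= f' x)%E.
  rewrite /phi patchE; case: ifPn => // /set_mem Zx.
  have fx : (f x <= k%:E * f' x + g x)%E.
    by apply: contrapT => fx; apply: Zx; exact: fZ.
  rewrite /phi0 ge_max f'0/= lee_pdivrMl//.
  have := g0 x; case: (g x) fx => [r fx _|_ _|//]; last by rewrite addeNy leNye.
  by rewrite leeBlDr//; exact: le_trans fx.
apply: (@le_trans _ _ (k%:E * \int[mu]_x phi x + \int[mu]_x g x)%E); last first.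
  rewrite leeD2r// lee_pmul2l// !ge0_integralTE//.
  apply: ereal_sup_le => _ [t tp <-].
  by exists t => // x; exact: le_trans (phif' x).
rewrite -ge0_integralZl_EFin//; last exact: ltW.
rewrite -ge0_integralD//; last 2 first.
  by move=> x _; rewrite mule_ge0// lee_fin ltW.
  exact: measurable_funeM.
rewrite -integralT_nnsfun; apply: ae_ge0_le_integral => //.
- by move=> x _; rewrite lee_fin.
- by move=> x _; rewrite adde_ge0// mule_ge0// lee_fin ltW.
- by apply: emeasurable_funD => //; exact: measurable_funeM.
exists Z; split=> // x /= sx; apply: contrapT => Zx; apply: sx => _.
rewrite /phi patchE ifT; last exact/mem_set.
rewrite /phi0; have := g0 x; case: (g x) => [r _|_|//]; last first.
  rewrite addey ?leey// -ltNye (@lt_le_trans _ _ 0%E)//.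
  by rewrite mule_ge0 ?lee_fin ?(ltW k0)// le_max lexx.
rewrite -leeBlDr// -lee_pdivrMl//.
by rewrite le_max lexx orbT.
Qed.

(** With [a] the mean of [u], the difference [(u - c)^2 - (u - a)^2] is affine in [u] and integrates
    to [(a - c)^2] times the measure of [D]. *)
Lemma integral_sqrB_average_le (D : set T) (u : T -> R) (c : R) :
  measurable D -> (0 < mu D < +oo)%E -> measurable_fun D u ->
  [bounded u x | x in D] ->
  (\int[mu]_(x in D) ((u x - (fine (mu D))^-1 * \int[mu]_(y in D) u y) ^+ 2)%:E
    <= \int[mu]_(x in D) ((u x - c) ^+ 2)%:E)%E.
Proof.
move=> mD /andP[D0 Doo] mfu bu.
move aE : (_ * \int[mu]_(y in D) u y) => a.
have iu : mu.-integrable D (EFin \o u) by exact: measurable_bounded_integrable.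
have icst r : mu.-integrable D (EFin \o cst r).
  apply: measurable_bounded_integrable => //.
  by exists `|r|; split => // M rM x _ /=; exact: ltW.
have isqr : mu.-integrable D (EFin \o (fun x => (u x - a) ^+ 2)).
  apply: measurable_bounded_integrable => //.
    by apply: measurable_funX; exact: measurable_funB.
  have [M [Mr uM]] := bu.
  (* The hypothesis bounds [u] by every real strictly above [M], and [M] may be negative; [|M| + 1]
     is such a real. *)
  exists ((`|M| + 1 + `|a|) ^+ 2); split; first exact: num_real.
  move=> r Mr' x Dx /=; apply: le_trans (ltW Mr').
  rewrite normrX lerXn2r ?nnegrE// (le_trans (ler_normB _ _))// lerD2r.
  by apply: uM => //; rewrite (le_lt_trans (ler_norm _))// ltrDl.
have ilin : mu.-integrable D (EFin \o (fun x => 2 * (a - c) * u x)).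
  by have := @integrableZl _ _ _ _ _ mD (2 * (a - c)) _ iu.
have iaff : mu.-integrable D
    (EFin \o (fun x => 2 * (a - c) * u x + (c ^+ 2 - a ^+ 2))).
  exact: (integrableD mD ilin (icst _)).
rewrite [leRHS](_ : _ = \int[mu]_(x in D) (EFin \o (fun x => (u x - a) ^+ 2)%R \+
    (EFin \o (fun x => 2 * (a - c) * u x + (c ^+ 2 - a ^+ 2))%R)) x)%E; last first.
  apply: eq_integral => x _ /=; rewrite -EFinD; congr EFin.
  by ring.
rewrite integralD_EFin// leeDl//.
have -> : (\int[mu]_(x in D)
    (EFin \o (fun x => 2 * (a - c) * u x + (c ^+ 2 - a ^+ 2))%R) x =
    (\int[mu]_(x in D) (2 * (a - c) * u x + (c ^+ 2 - a ^+ 2))%R)%:E)%E.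
  by rewrite fineK//; exact: integrable_fin_num.
have -> : \int[mu]_(x in D) (2 * (a - c) * u x + (c ^+ 2 - a ^+ 2)) =
    2 * (a - c) * \int[mu]_(x in D) u x + (c ^+ 2 - a ^+ 2) * fine (mu D).
  by rewrite (RintegralD mD ilin (icst _)) RintegralZl// Rintegral_cst.
have muD0 : 0 < fine (mu D) by exact/fine_gt0/andP.
have -> : \int[mu]_(x in D) u x = a * fine (mu D).
  by rewrite -aE mulrAC mulVf ?mul1r// gt_eqF.
rewrite lee_fin (_ : _ + _ = (a - c) ^+ 2 * fine (mu D)); last by ring.
by rewrite mulr_ge0 ?sqr_ge0// ltW.
Qed.

End integral.

(** * Norms, polynomials and bounded sets of row vectors *)

Section row_vectors.
Variable R : realType.

Lemma enorm_ge0 n (v : 'rV[R]_n) : 0 <= enorm v.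
Proof. exact: sqrtr_ge0. Qed.

Lemma sqr_enorm n (v : 'rV[R]_n) : enorm v ^+ 2 = \sum_i v ord0 i ^+ 2.
Proof. by rewrite sqr_sqrtr// sumr_ge0// => i _; exact: sqr_ge0. Qed.

Lemma normr_coord_le n (v : 'rV[R]_n) i : `|v ord0 i| <= `|v|.
Proof.
rewrite [leRHS]/Num.norm /= mx_normrE.
exact: (le_bigmax _ (fun ij : 'I_1 * 'I_n => `|v ij.1 ij.2|) (ord0, i)).
Qed.

(** [|v|] is the maximum norm. Lipschitz continuity is expressed with it, diameters and L2 norms
    with [enorm], so comparisons in both directions are required. *)
Lemma normr_le_enorm n (v : 'rV[R]_n) : `|v| <= enorm v.
Proof.
rewrite [leLHS]/Num.norm /= mx_normrE; apply: bigmax_le => [|[k i] _ /=].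
  exact: enorm_ge0.
rewrite -[leLHS]sqrtr_sqr ler_wsqrtr// [k]ord1.
by rewrite (bigD1 i)//= lerDl sumr_ge0// => j _; exact: sqr_ge0.
Qed.

Lemma sqr_enorm_le n (v : 'rV[R]_n) : enorm v ^+ 2 <= n%:R * `|v| ^+ 2.
Proof.
rewrite sqr_enorm (le_trans (ler_sum _ (fun i _ => _ : _ <= `|v| ^+ 2)))//.
  by move=> i _; rewrite -real_normK ?num_real// lerXn2r ?nnegrE ?normr_coord_le.
by rewrite sumr_const card_ord mulr_natl.
Qed.

(** Stands in for Minkowski's inequality: it applies pointwise under the integral, at the price of a
    factor 2. *)
Lemma sqr_enormD_le n (u v : 'rV[R]_n) :
  enorm (u + v) ^+ 2 <= 2 * enorm u ^+ 2 + 2 * enorm v ^+ 2.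
Proof.
rewrite !sqr_enorm !mulr_sumr -big_split/=; apply: ler_sum => i _.
rewrite mxE; move: (u _ _) (v _ _) => a b.
by rewrite -subr_ge0 (_ : _ - _ = (a - b) ^+ 2) ?sqr_ge0//; ring.
Qed.

Lemma sqr_enormZ n (a : R) (v : 'rV[R]_n) :
  enorm (a *: v) ^+ 2 = a ^+ 2 * enorm v ^+ 2.
Proof.
by rewrite !sqr_enorm mulr_sumr; apply: eq_bigr => i _; rewrite mxE exprMn.
Qed.

Lemma sqr_enormB n (u v : 'rV[R]_n) : enorm (u - v) ^+ 2 = enorm (v - u) ^+ 2.
Proof. by rewrite -opprB -scaleN1r sqr_enormZ sqrrN expr1n mul1r. Qed.

Lemma measurable_polynomial_order n m p (f : 'rV[R]_n -> 'rV[R]_m) j :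
  polynomial_order p f ->
  measurable_fun [set: 'rV[R]_n] (fun x => f x ord0 j).
Proof.
move=> [c fE].
rewrite (_ : (fun x => _) = (fun x : 'rV[R]_n => \sum_(k : {ffun 'I_n -> 'I_p.+1})
    (\prod_i x ord0 i ^+ k i) * c k ord0 j)); last first.
  by apply/funext => x; rewrite fE summxE; apply: eq_bigr => k _; rewrite mxE.
apply: measurable_sum => k; apply: measurable_funM => //.
apply: measurable_prod => i _; apply: measurable_funX.
exact: measurable_coord.
Qed.

(** On an element of finite measure this yields the integrability that the optimality of the average
    relies on. *)
Lemma bounded_polynomial_order n m p (f : 'rV[R]_n -> 'rV[R]_m) j A :
  bounded_set A -> polynomial_order p f -> [bounded f x ord0 j | x in A].
Proof.
move=> [M [_ AM]] [c fE]; pose B : R := `|M| + 1.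
have AB x i : A x -> `|x ord0 i| <= B.
  move=> Ax; rewrite (le_trans (normr_coord_le _ _))// AM//.
  by rewrite (le_lt_trans (ler_norm _))// ltrDl.
exists (\sum_(k : {ffun 'I_n -> 'I_p.+1}) (\prod_i B ^+ k i) * `|c k ord0 j|).
split=> [|r Br x Ax]; first exact: num_real.
apply: le_trans (ltW Br); rewrite fE summxE (le_trans (ler_norm_sum _ _ _))//.
apply: ler_sum => k _; rewrite mxE normrM ler_wpM2r// normr_prod.
by apply: ler_prod => i _; rewrite normr_ge0/= normrX lerXn2r ?nnegrE ?addr_ge0// AB.
Qed.

Lemma measurable_sqr_enorm d (T : measurableType d) n (f : T -> 'rV[R]_n) D :
  (forall j, measurable_fun D (fun x => f x ord0 j)) ->
  measurable_fun D (fun x => (enorm (f x) ^+ 2)%:E).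
Proof.
move=> mf; apply/measurable_EFinP.
under eq_fun do rewrite sqr_enorm.
by apply: measurable_sum => j; exact: measurable_funX.
Qed.

(** Both integrals split into sums over the coordinates, and the average is taken coordinatewise,
    which reduces the claim to scalar functions. *)
Lemma integral_sqr_enorm_average_le n m (f : 'rV[R]_n -> 'rV[R]_m) A c :
  measurable A -> (0 < lebesgue_rV R n A < +oo)%E ->
  (forall j, measurable_fun A (fun x => f x ord0 j)) ->
  (forall j, [bounded f x ord0 j | x in A]) ->
  (\int[lebesgue_rV R n]_(x in A) (enorm (average A f - f x) ^+ 2)%:E <=
   \int[lebesgue_rV R n]_(x in A) (enorm (f x - c) ^+ 2)%:E)%E.
Proof.
move=> mA A0 mf bf.
have sumE a : (\int[lebesgue_rV R n]_(x in A) (enorm (f x - a) ^+ 2)%:E =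
  \sum_j \int[lebesgue_rV R n]_(x in A) ((f x ord0 j - a ord0 j) ^+ 2)%:E)%E.
  rewrite -ge0_integral_sum//; last 2 first.
  - move=> j; apply/measurable_EFinP; apply: measurable_funX.
    exact: measurable_funB.
  - by move=> j x _; rewrite lee_fin sqr_ge0.
  apply: eq_integral => x _; rewrite sqr_enorm sumEFin; congr EFin.
  by apply: eq_bigr => j _; rewrite !mxE.
under eq_integral do rewrite sqr_enormB.
rewrite !sumE; apply: lee_sum => j _; rewrite mxE.
exact: integral_sqrB_average_le.
Qed.

Lemma enormB_le_diameter n (A : set 'rV[R]_n) (h : R) x y :
  (diameter A <= h%:E)%E -> A x -> A y -> enorm (x - y) <= h.
Proof.
move=> Ah Ax Ay; rewrite -lee_fin; apply: le_trans Ah.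
by apply: ereal_sup_ubound; exists x => //; exists y.
Qed.

Lemma bounded_set_diameter n (A : set 'rV[R]_n) (h : R) :
  (diameter A <= h%:E)%E -> bounded_set A.
Proof.
move=> Ah; have [[a Aa]|A0] := pselect (A !=set0); last first.
  by exists 0; split => // M _ x Ax; exfalso; apply: A0; exists x.
exists (h + `|a|); split; first exact: num_real.
move=> M hM x Ax /=; apply: le_trans (ltW hM).
rewrite -[x](subrK a) (le_trans (ler_normD _ _))// lerD2r.
rewrite (le_trans (normr_le_enorm _))//.
exact: (enormB_le_diameter Ah).
Qed.

(** A box around [A] gives a finite measure to compare with, although [A] may fail to be
    measurable. *)
Lemma bounded_set_lebesgue_rV n (A : set 'rV[R]_n) : bounded_set A ->
  exists B, [/\ measurable B, A `<=` B & (lebesgue_rV R n B < +oo)%E].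
Proof.
move=> [M [_ AM]]; pose b : R := `|M| + 1.
pose B := \bigcap_(i in [set: 'I_n])
  ((fun v : 'rV[R]_n => v ord0 i) @^-1` `[- b, b]%classic).
exists B; split.
- apply: fin_bigcap_measurable => [|i _]; first exact: finite_finset.
  by rewrite -[X in measurable X]setTI; exact: measurable_coord.
- move=> x Ax i _; rewrite /= in_itv/= -ler_norml.
  rewrite (le_trans (normr_coord_le _ _))// AM//.
  by rewrite (le_lt_trans (ler_norm _))// ltrDl.
pose b_ : 'rV[R]_n := const_mx b.
rewrite (_ : B = [set v | forall i, v ord0 i \in `[(- b_) ord0 i, b_ ord0 i]]).
  rewrite lebesgue_rV_box ?ltry// => i.
  by rewrite !mxE ge0_cp ?addr_ge0.
apply/seteqP; split => v /= Bv i => [|_].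
  by rewrite !mxE; exact: Bv.
by have := Bv i; rewrite !mxE.
Qed.

End row_vectors.

(** * Meshes up to null sets, and integrals of elementwise functions *)

Lemma ae_forall d (T : measurableType d) (R : realType)
    (mu : {measure set T -> \bar R}) (I : finType) (P : I -> T -> Prop) :
  (forall i, {ae mu, forall x, P i x}) -> {ae mu, forall x i, P i x}.
Proof. exact: (@filter_forall _ _ _ _ (ae_filter_ringOfSetsType mu)). Qed.

Section mesh.
Context d (T : measurableType d) (R : realType).
Variables (mu : {measure set T -> \bar R}) (N : nat) (K : 'I_N -> set T).
Hypothesis mK : forall e, measurable (K e).
Variable G : 'I_N -> T -> \bar R.
Local Open Scope ereal_scope.

(* The function glued from the [G e] on the [K e]; on overlaps they add up. *)
Definition broken (x : T) : \bar R := \sum_e (G e \_ (K e)) x.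

Lemma brokenE x e : K e x -> (forall e', K e' x -> e' = e) ->
  broken x = G e x.
Proof.
move=> Kx Ku; rewrite /broken (bigD1 e)//= big1 => [|e' e'e].
  by rewrite adde0 patchE mem_set.
by rewrite patchE memNset// => /Ku /eqP; rewrite (negbTE e'e).
Qed.

Lemma broken_eq0 x : (forall e, ~ K e x) -> broken x = 0.
Proof.
by move=> Kx; rewrite /broken big1// => e _; rewrite patchE memNset.
Qed.

Hypothesis G0 : forall e x, 0 <= G e x.
Hypothesis mG : forall e, measurable_fun [set: T] (G e).

Lemma broken_ge0 x : 0 <= broken x.
Proof. by apply: sume_ge0 => e _; rewrite patchE; case: ifP. Qed.

Let measurable_patch e : measurable_fun [set: T] (G e \_ (K e)).
Proof.
by apply/(measurable_restrictT _ _).1 => //; exact: measurable_funTS.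
Qed.

Lemma measurable_broken : measurable_fun [set: T] broken.
Proof. by apply: emeasurable_sum => e. Qed.

(** Because the contributions add up on overlaps, the equality is exact even when the [K e] are not
    disjoint. *)
Lemma integral_broken :
  \int[mu]_x broken x = \sum_e \int[mu]_(x in K e) G e x.
Proof.
rewrite ge0_integral_sum//; last by move=> e x _; rewrite patchE; case: ifP.
by apply: eq_bigr => e _; rewrite -integral_mkcond.
Qed.

End mesh.

Section mesh_partition.
Context (R : realType) (n : nat) (Omega : set 'rV[R]_n) (N : nat).
Variable K : 'I_N -> set 'rV[R]_n.
Hypothesis mesh : mesh_partition Omega K.

(** The discarded null set consists of the points where [Omega] differs from the union of the
    elements, and of the finitely many pairwise overlaps. *)
Lemma mesh_partition_ae : {ae lebesgue_rV R n, forall x,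
  (Omega x <-> exists e, K e x) /\ forall e e', K e x -> K e' x -> e = e'}.
Proof.
have [mK _ KI KO] := mesh; apply: filterI.
  rewrite setY_def in KO; apply: negligibleS KO => x /= OK.
  have [Ox|Ox] := pselect (Omega x); [left|right]; split=> //.
    by move=> [e _ Kx]; apply: OK; split=> // _; exists e.
  apply: contrapT => Kx; apply: OK; split=> // -[e Kex].
  by exfalso; apply: Kx; exists e.
apply: ae_forall => e; apply: ae_forall => e'.
have [->|/KI] := eqVneq e e'; first exact: filterE.
by apply: negligibleS => x /= KK; apply: contrapT => Kx; apply: KK => Kex Ke'x;
  exfalso; apply: Kx.
Qed.

(** The elements lie in [B] up to a null set [Z], and enlarging [B] by [Z] does not increase its
    measure. This bounds the total measure of the elements independently of the mesh. *)
Lemma measure_mesh_partition_le B : measurable B -> Omega `<=` B ->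
  (lebesgue_rV R n (\bigcup_e K e) <= lebesgue_rV R n B)%E.
Proof.
have [mK _ _ [Z [mZ Z0 OZ]]] := mesh => mB OB.
have mU : measurable (\bigcup_e K e) by exact: fin_bigcup_measurable.
apply: (@le_trans _ _ (lebesgue_rV R n (B `|` Z))).
  rewrite le_measure ?inE//; first exact: measurableU.
  move=> x Kx; have [Ox|Ox] := pselect (Omega x); first by left; exact: OB.
  by right; apply: OZ; rewrite setY_def; right.
by rewrite (le_trans (measureU2 _ _ _))// [X in (_ + X)%E]Z0 adde0.
Qed.

End mesh_partition.

(** * The error of the limited solution on a single mesh *)

(** The error is split twice: [LU - Uex] into the DG error and the limiter correction, then
    [Ue e - c e] into the DG error and the oscillation of [Uex] on the element. The inner
    parenthesis is the bound from the second splitting. *)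
Lemma limited_error_le (R : realType) (n m p : nat) (Omega B : set 'rV[R]_n)
    (N : nat) (K : 'I_N -> set 'rV[R]_n) (Uex U LU : 'rV[R]_n -> 'rV[R]_m)
    (Ue : 'I_N -> 'rV[R]_n -> 'rV[R]_m) (eps : 'I_N -> R) (h L b : R) :
  measurable B -> Omega `<=` B -> (lebesgue_rV R n B < +oo)%E ->
  mesh_partition Omega K ->
  (forall e, (diameter (K e) <= h%:E)%E) ->
  (forall e, polynomial_order p (Ue e)) ->
  has_restrictions K U Ue ->
  has_restrictions K LU (fun e => limited (K e) (eps e) (Ue e)) ->
  (forall e, 0 <= eps e <= b) -> 0 <= L ->
  (forall x y, Omega x -> Omega y -> `|Uex x - Uex y| <= L * `|x - y|) ->
  (L2norm Omega (fun x => LU x - Uex x)%R ^+ 2 <=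
   2%:E * L2norm Omega (fun x => U x - Uex x)%R ^+ 2 + (2 * b ^+ 2)%:E *
     (2%:E * L2norm Omega (fun x => U x - Uex x)%R ^+ 2 +
      (2 * (m%:R * (L * h) ^+ 2))%:E * lebesgue_rV R n B))%E.
Proof.
move=> mB OB Boo mesh diamK polyU restrU restrLU eps_b L0 lipU.
have [mK K0 _ _] := mesh; set mu := lebesgue_rV R n.
have mU : measurable (\bigcup_e K e) by exact: fin_bigcup_measurable.
have muU := measure_mesh_partition_le mesh mB OB.
have muKoo e : (mu (K e) < +oo)%E.
  apply: le_lt_trans Boo; apply: le_trans muU.
  by rewrite le_measure ?inE// => x Kx; exists e.
have mUe e j : measurable_fun [set: 'rV[R]_n] (fun x => Ue e x ord0 j).
  exact: measurable_polynomial_order (polyU e).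
(* The constant is the value of [Uex] at a point of the element inside [Omega], where the Lipschitz
   bound holds; without such a point the condition is vacuous. The factor [m%:R] is the cost of
   passing from the maximum norm to [enorm]. *)
have /choice[c cP] e : exists c, forall x, K e x -> Omega x ->
    enorm (Uex x - c) ^+ 2 <= m%:R * (L * h) ^+ 2.
  have [[y [Ky Oy]]|KO] := pselect (K e `&` Omega !=set0); last first.
    by exists 0 => x Kx Ox; exfalso; apply: KO; exists x.
  exists (Uex y) => x Kx Ox; rewrite (le_trans (sqr_enorm_le _))//.
  have xyh := enormB_le_diameter (diamK e) Kx Ky.
  have h0 : 0 <= h := le_trans (enorm_ge0 _) xyh.
  rewrite ler_wpM2l// lerXn2r ?nnegrE ?mulr_ge0// (le_trans (lipU _ _ Ox Oy))//.
  by rewrite ler_wpM2l// (le_trans (normr_le_enorm _)).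
(* Extension by zero makes every error an integral over the whole space, as [ge0_ae_le_integralD]
   expects. *)
pose errp V := (fun x => (enorm (V x - Uex x) ^+ 2)%:E) \_ Omega.
pose err V := (\int[mu]_x errp V x)%E.
have errE V : (L2norm Omega (fun x => V x - Uex x)%R ^+ 2 = err V)%E.
  rewrite /L2norm sqr_sqrte; first by rewrite integral_mkcond.
  by apply: integral_ge0 => x _; rewrite lee_fin sqr_ge0.
have errp_ge0 V x : (0 <= errp V x)%E.
  by rewrite /errp patchE; case: ifP => // _; rewrite lee_fin sqr_ge0.
pose G e x := ((2 * b ^+ 2)%:E *
  (enorm (average (K e) (Ue e) - Ue e x) ^+ 2)%:E)%E.
pose H e x := (enorm (Ue e x - c e) ^+ 2)%:E.
have G0 e x : (0 <= G e x)%E.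
  by rewrite mule_ge0 ?lee_fin ?sqr_ge0// mulr_ge0 ?sqr_ge0.
have H0 e x : (0 <= H e x)%E by rewrite lee_fin sqr_ge0.
have mavg e : measurable_fun [set: 'rV[R]_n]
    (fun x => (enorm (average (K e) (Ue e) - Ue e x) ^+ 2)%:E).
  apply: measurable_sqr_enorm => j; under eq_fun do rewrite !mxE.
  exact: measurable_funB.
have mG e : measurable_fun [set: 'rV[R]_n] (G e) by exact: measurable_funeM.
have mH e : measurable_fun [set: 'rV[R]_n] (H e).
  apply: measurable_sqr_enorm => j; under eq_fun do rewrite !mxE.
  exact: measurable_funB.
have Lh0 : 0 <= 2 * (m%:R * (L * h) ^+ 2).
  by rewrite mulr_ge0// mulr_ge0// sqr_ge0.
have restrUe := ae_forall restrU.
have restrLUe := ae_forall restrLU.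
(* Second splitting. The measurable summand split off is a constant on the union of the elements,
   whose measure is at most that of [B]. *)
have intH : (\int[mu]_x broken K H x <= 2%:E * err U +
    (2 * (m%:R * (L * h) ^+ 2))%:E * mu B)%E.
  apply: (@le_trans _ _ (2%:E * err U + \int[mu]_x
      ((cst (2 * (m%:R * (L * h) ^+ 2))%:E) \_ (\bigcup_e K e)) x)%E).
    apply: ge0_ae_le_integralD => //.
    - exact: broken_ge0.
    - apply/(measurable_restrictT _ _).1 => //; exact: measurable_cst.
    - by move=> x; rewrite patchE; case: ifP.
    move: (mesh_partition_ae mesh) restrUe.
    apply: filterS2 => x [[_ OK] Ku] Ux.
    have [[e Kx]|Kx] := pselect (exists e, K e x); last first.
      rewrite broken_eq0; last by move=> e Kex; apply: Kx; exists e.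
      by rewrite adde_ge0 ?mule_ge0// patchE; case: ifP.
    rewrite (brokenE _ Kx); last by move=> e' Ke'; exact: Ku.
    have Ox : Omega x by apply: OK; exists e.
    rewrite /errp !patchE !mem_set//; last by exists e.
    rewrite /H -EFinM -EFinD lee_fin -(Ux e Kx).
    rewrite (_ : U x - c e = (U x - Uex x) + (Uex x - c e)); last first.
      by rewrite addrA subrK.
    apply: le_trans (sqr_enormD_le _ _) _; rewrite lerD2l ler_wpM2l//.
    exact: cP.
  rewrite leeD2l// -integral_mkcond integral_cst//.
  by rewrite lee_wpmul2l// lee_fin.
rewrite !errE.
(* First splitting. The correction is dominated by the measurable function [broken K G], since
   [eps e] is at most [b]. *)
apply: (@le_trans _ _ (2%:E * err U + \int[mu]_x broken K G x)%E).
  apply: ge0_ae_le_integralD => //.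
  - exact: measurable_broken.
  - exact: broken_ge0.
  move: (mesh_partition_ae mesh) restrUe restrLUe.
  apply: filterS3 => x [[OK _] Ku] Ux LUx.
  have [Ox|Ox] := pselect (Omega x); last first.
    rewrite [leLHS]patchE memNset// adde_ge0 ?mule_ge0 ?lee_fin//.
    exact: broken_ge0.
  have [e Kx] := OK Ox.
  rewrite (brokenE _ Kx); last by move=> e' Ke'; exact: Ku.
  rewrite /errp !patchE !mem_set// /G -!EFinM -EFinD lee_fin.
  rewrite (LUx e Kx) /limited -(Ux e Kx) addrAC.
  apply: le_trans (sqr_enormD_le _ _) _; rewrite lerD2l -mulrA ler_wpM2l//.
  rewrite sqr_enormZ ler_wpM2r ?sqr_ge0//.
  by have /andP[e0 eb] := eps_b e; rewrite lerXn2r ?nnegrE// (le_trans e0).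
rewrite leeD2l// integral_broken//.
(* It remains to compare [G] with [H] on each element, where the average does at least as well as
   the constant [c e]. *)
apply: le_trans (lee_wpmul2l _ intH); last by rewrite lee_fin mulr_ge0 ?sqr_ge0.
rewrite integral_broken// ge0_sume_distrr; last first.
  by move=> e _; exact: integral_ge0.
have b0 : 0 <= 2 * b ^+ 2 by rewrite mulr_ge0 ?sqr_ge0.
apply: lee_sum => e _; rewrite ge0_integralZl_EFin//; last 2 first.
- by move=> x _; rewrite lee_fin sqr_ge0.
- exact: measurable_funTS.
rewrite lee_wpmul2l//.
apply: integral_sqr_enorm_average_le => //.
- by rewrite K0 muKoo.
- by move=> j; exact: measurable_funTS.
- move=> j; apply: (bounded_polynomial_order _ _ (polyU e)).
  exact: bounded_set_diameter (diamK e).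
Qed.

(** * The estimate with a constant uniform in [h] *)

Theorem mainTheorem5 (R : realType) (Nd m p : nat) (Omega : set 'rV[R]_Nd)
    (N : R -> nat) (K : forall h : R, 'I_(N h) -> set 'rV[R]_Nd)
    (Uex : 'rV[R]_Nd -> 'rV[R]_m) (U LU : R -> 'rV[R]_Nd -> 'rV[R]_m)
    (Ue : forall h : R, 'I_(N h) -> 'rV[R]_Nd -> 'rV[R]_m)
    (eps : forall h : R, 'I_(N h) -> R) (C1 C : R)
    (Nd_gt0 : (0 < Nd)%N) (m_gt0 : (0 < m)%N) (p_ge1 : (1 <= p)%N)
    (Omega_neq0 : Omega !=set0) (Omega_open : open Omega)
    (Omega_connected : connected Omega) (Omega_bounded : bounded_set Omega)
    (Uex_smooth : smooth Omega Uex)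
    (K_mesh : forall h : R, 0 < h <= 1 -> mesh_partition Omega (K h))
    (K_diam : forall h : R, 0 < h <= 1 -> forall e, (diameter (K h e) <= h%:E)%E)
    (Ue_poly : forall h : R, 0 < h <= 1 -> forall e, polynomial_order p (Ue h e))
    (U_restr : forall h : R, 0 < h <= 1 -> has_restrictions (K h) (U h) (Ue h))
    (U_err : forall h : R, 0 < h <= 1 ->
      (L2norm Omega (fun x => U h x - Uex x)%R <= (C1 * h ^+ (p + 1))%:E)%E)
    (eps_01 : forall h : R, 0 < h <= 1 -> forall e, 0 <= eps h e <= 1)
    (eps_le : forall h : R, 0 < h <= 1 -> forall e, eps h e <= C * h ^+ p)
    (LU_restr : forall h : R, 0 < h <= 1 ->
      has_restrictions (K h) (LU h)
        (fun e => limited (K h e) (eps h e) (Ue h e))) :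
  exists C2 : R, forall h : R, 0 < h <= 1 ->
    (L2norm Omega (fun x => LU h x - Uex x)%R ^+ 2
       <= (C2 * h ^+ (2 * p + 2))%:E)%E.
Proof.
have [_ _ [L [_ lipU]]] := Uex_smooth.
have [B [mB OB Boo]] := bounded_set_lebesgue_rV Omega_bounded.
(* The box [B] depends on [Omega] alone, so [M] is common to all [h]. *)
have [M M0 muB] : exists2 M, 0 <= M & lebesgue_rV R Nd B = M%:E.
  exists (fine (lebesgue_rV R Nd B)); first by rewrite fine_ge0.
  by rewrite fineK// ge0_fin_numE.
pose L1 : R := `|L| + 1.
have {}lipU x y : Omega x -> Omega y -> `|Uex x - Uex y| <= L1 * `|x - y|.
  move=> Ox Oy; have := lipU L1 _ (x, y); apply=> //.
  by rewrite /L1 (le_lt_trans (ler_norm _))// ltrDl.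
(* This is the bound of [limited_error_le] for [b := C * h ^+ p], with [h ^+ (2 * p + 2)] factored
   out and the surplus factor [(h ^+ p) ^+ 2], which is at most 1, replaced by 1. *)
exists (2 * C1 ^+ 2 + 2 * C ^+ 2 * (2 * C1 ^+ 2 +
  2 * (m%:R * L1 ^+ 2) * M)) => h h01.
have [h0 h1] := andP h01.
have eps_b e : 0 <= eps h e <= C * h ^+ p.
  by rewrite eps_le// andbT; have /andP[] := eps_01 h h01 e.
have L10 : 0 <= L1 by rewrite addr_ge0.
have := limited_error_le mB OB Boo (K_mesh h h01) (K_diam h h01)
  (Ue_poly h h01) (U_restr h h01) (LU_restr h h01) eps_b L10 lipU.
set eLU := (L2norm _ _ ^+ 2)%E; set eU := (L2norm _ _ ^+ 2)%E => /le_trans; apply.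
have eUle : (eU <= ((C1 * h ^+ (p + 1)) ^+ 2)%:E)%E.
  by rewrite /eU expe2 expr2 EFinM lee_pmul ?U_err// sqrte_ge0.
have eU2le : (2%:E * eU <= (2 * (C1 * h ^+ (p + 1)) ^+ 2)%:E)%E.
  by rewrite EFinM lee_wpmul2l.
have Cb0 : 0 <= 2 * (C * h ^+ p) ^+ 2 by rewrite mulr_ge0 ?sqr_ge0.
apply: (le_trans (leeD eU2le (lee_wpmul2l _ (leeD2r _ eU2le)))) => //.
rewrite muB -!(EFinM, EFinD) lee_fin.
have -> : (2 * p + 2 = (p + 1) * 2)%N by rewrite mulnDl mulnC.
rewrite exprM exprD expr1 !exprMn.
have : 0 <= h ^+ p <= 1 by rewrite exprn_ge0 ?exprn_ile1 ?(ltW h0).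
move: (h ^+ p) (m%:R : R) => q k /andP[q0 q1].
have q21 : q ^+ 2 <= 1 by rewrite expr_le1.
(* The slack comes only from that replacement, in the term where the limiter bound multiplies the DG
   error. *)
rewrite -subr_ge0 (_ : _ - _ = 4 * (C * C1) ^+ 2 * (q * h) ^+ 2 * (1 - q ^+ 2)).
  by rewrite mulr_ge0 ?subr_ge0// mulr_ge0 ?sqr_ge0// mulr_ge0 ?sqr_ge0.
by ring.
Qed.
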